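(* Every graphon with a bounded clique number is countably-partite. That is, if $W:\Omega^2\to[0,1]$ is a graphon with $\lim_{n\to\infty}\mathbb E[\omega(\mathbb G(n,W))]<+\infty$, then there is a measurable partition $\Omega=\Omega_1\,\dot\cup\,\Omega_2\,\dot\cup\cdots$ into countably many sets such that for each $i$, $W$ restricted to $\Omega_i\times\Omega_i$ is $0$ almost everywhere.
   Context: A graphon is a symmetric measurable function $W:\Omega^2\to[0,1]$, where $\Omega$ is an atomless standard Borel probability space with probability measure $\nu$. The random graph $\mathbb G(n,W)$ has vertex set $\{1,\dots,n\}$: sample $x_1,\dots,x_n\in\Omega$ independently according to $\nu$, then join $i\neq j$ by an edge independently with probability $W(x_i,x_j)$. $\omega(G)$ denotes the clique number of a graph $G$. The sequence $\mathbb E[\omega(\mathbb G(n,W))]$ is nondecreasing in $n$, so the limit exists in $[1,+\infty]$. *)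

(* Defs.v *)
From HB Require Import structures.
From mathcomp Require Import all_boot all_order all_algebra.
From mathcomp Require Import all_classical all_reals all_analysis.

Set Implicit Arguments.
Unset Strict Implicit.
Unset Printing Implicit Defensive.
Import Order.TTheory GRing.Theory Num.Theory.

Local Open Scope classical_set_scope.
Local Open Scope ring_scope.

Definition complete_metric (R : realType) (X : metricType R) : Prop :=
  forall F : set_system X, ProperFilter F -> cauchy F -> exists x : X, F --> x.

Definition separable (X : topologicalType) : Prop :=
  exists2 D : set X, countable D & dense D.

(* The sigma-algebra of T is the Borel sigma-algebra of a Polish topology,
   which is transported to T along the bijection f. *)
Definition standard_borel (R : realType) d (T : measurableType d) : Prop :=
  exists (X : metricType R) (f : T -> X),
    [/\ complete_metric X, separable X, bijective f &
        forall B : set X,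
          measurable (f @^-1` B) <-> <<s [set U : set X | open U] >> B].

Definition atom (R : realType) d (T : measurableType d)
    (nu : {measure set T -> \bar R}) (A : set T) : Prop :=
  [/\ measurable A, (0 < nu A)%E &
      forall B, measurable B -> B `<=` A -> nu B = 0%E \/ nu B = nu A].

Definition atomless (R : realType) d (T : measurableType d)
    (nu : {measure set T -> \bar R}) : Prop :=
  forall A, ~ atom nu A.

Definition is_graphon (R : realType) d (T : measurableType d)
    (W : T * T -> R) : Prop :=
  [/\ measurable_fun [set: T * T] W,
      forall x y, W (x, y) = W (y, x) &
      forall x y, 0 <= W (x, y) <= 1].

Section tuple_power.
Context (R : realType) d (T : measurableType d).

Definition tcons n (p : T * n.-tuple T) : n.+1.-tuple T := [tuple of p.1 :: p.2].

Lemma measurable_tcons n : measurable_fun [set: T * n.-tuple T] (@tcons n).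
Proof. by apply: measurable_cons. Qed.

HB.instance Definition _ n :=
  isMeasurableFun.Build _ _ _ _ (@tcons n) (@measurable_tcons n).

(* The n-fold product measure: the law of n independent samples from nu. *)
Fixpoint tuple_power (nu : probability T R) (n : nat) :
    probability (n.-tuple T) R :=
  match n with
  | 0 => \d_([tuple] : 0.-tuple T)
  | m.+1 => distribution (nu \x tuple_power nu m)%E (@tcons m)
  end.

End tuple_power.

Section finite_graphs.
Context (n : nat).

(* A simple graph on 'I_n is a subset E of vpairs: the edge joining i < j is
   recorded as the pair (i, j). *)
Definition vpairs : {set 'I_n * 'I_n} :=
  [set p : 'I_n * 'I_n | (p.1 < p.2)%N]%SET.

Definition adj (E : {set 'I_n * 'I_n}) : rel 'I_n :=
  fun i j => ((i, j) \in E) || ((j, i) \in E).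

Definition is_clique (E : {set 'I_n * 'I_n}) (K : {set 'I_n}) : bool :=
  [forall i in K, forall j in K, (i != j) ==> adj E i j].

Definition clique_number (E : {set 'I_n * 'I_n}) : nat :=
  (\max_(K : {set 'I_n} | is_clique E K) #|K|)%N.

End finite_graphs.

Section random_graph.
Context (R : realType) d (T : measurableType d).
Variables (nu : probability T R) (W : T * T -> R) (n : nat).

(* Probability of the graph E given the sampled points x. *)
Definition graph_weight (x : n.-tuple T) (E : {set 'I_n * 'I_n}) : R :=
  \prod_(p in vpairs n)
    (if p \in E then W (tnth x p.1, tnth x p.2)
     else 1 - W (tnth x p.1, tnth x p.2)).

(* Probability that G(n, W) is the graph E. *)
Definition random_graph (E : {set 'I_n * 'I_n}) : \bar R :=
  (\int[tuple_power nu n]_x (graph_weight x E)%:E)%E.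

Definition expected_clique_number : \bar R :=
  (\sum_(E in powerset (vpairs n)) (clique_number E)%:R%:E * random_graph E)%E.

End random_graph.

(* Main.v *)
(* If for every k a random k-tuple of points spans a clique with positive
   probability, then cutting the n vertices into blocks of size k, each of which
   independently spans a clique with a fixed positive probability, shows that the
   expected clique number tends to infinity. Hence, for some k, almost no
   k-tuple spans a clique in the graph {W > 0}. By induction on k, such a graph
   is countably-partite: almost every neighbourhood is almost free of
   (k-1)-cliques, so it is countably-partite and almost contained in a
   countably-partite set B of maximal measure; hence the complement of B spans
   almost no edge. *)
Require Import Defs.
From HB Require Import structures.
From mathcomp Require Import all_boot all_order all_algebra.

Set Implicit Arguments.
Unset Strict Implicit.
Unset Printing Implicit Defensive.
Import Order.TTheory GRing.Theory Num.Theory.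
Local Open Scope ring_scope.

(** * Random subsets with independent elements *)

Section bernoulli_product.
Context (R : comNzRingType) (I : finType).
Implicit Types (V B E : {set I}) (a : I -> R).

(** The law of a random subset of [V] containing each [p] independently with probability [a p].
    Taking [V] to be [vpairs n] and [a] the values of [W] at fixed sample points gives
    [graph_weight]. *)
Definition bernoulli V a E : R :=
  \prod_(p in V) (if p \in E then a p else 1 - a p).

Lemma bernoulli_superset V B a : B \subset V ->
  \sum_(E in powerset V | B \subset E) bernoulli V a E = \prod_(p in B) a p.
Proof.
move=> /subsetP BV.
(* Expand [\prod_p (F p + G p)] over the sets [E] of indices where [F] is chosen. [F] vanishes off
   [V] and [G] on [B], so only [E] between [B] and [V] survive; [F + G] is [a] on [B] and 1
   elsewhere. *)
pose F p := if p \in V then a p else 0.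
pose G p := if p \in V then (if p \in B then 0 else 1 - a p) else 1.
have -> : \prod_(p in B) a p = \prod_p (F p + G p).
  rewrite big_mkcond; apply: eq_bigr => p _; rewrite /F /G.
  case: ifPn => [pB|pB]; first by rewrite BV// addr0.
  by case: ifP => _; [rewrite addrC subrK|rewrite add0r].
rewrite bigA_distr [RHS]/= big_mkcond; apply: eq_bigr => E _.
rewrite powersetE /bernoulli; case: ifPn => [/andP[EV BE]|].
  rewrite [LHS]big_mkcond; apply: eq_bigr => p _; rewrite /F /G.
  have [pE|pE] := boolP (p \in E); first by rewrite (subsetP EV _ pE).
  by rewrite (contraNF (subsetP BE p) pE).
rewrite negb_and => /orP[|] /subsetPn[p p1 p2].
  by rewrite (bigD1 p)//= p1 /F (negPf p2) mul0r.
by rewrite (bigD1 p)//= (negPf p2) /G p1 BV// mul0r.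
Qed.

Lemma bernoulli_avoid V (J : finType) (B : J -> {set I}) a :
    (forall j, B j \subset V) -> (forall i j, i != j -> [disjoint B i & B j]) ->
  \sum_(E in powerset V) bernoulli V a E * \prod_j (1 - (B j \subset E)%:R) =
  \prod_j (1 - \prod_(p in B j) a p).
Proof.
move=> BV Bdisj.
(* Inclusion-exclusion over the sets K of events [B j \subset E]. *)
have expand (c : J -> R) : \prod_j (1 - c j) =
    \sum_(K : {set J}) (\prod_(j in K) -1) * \prod_(j in K) c j.
  transitivity (\prod_j (- c j + 1)).
    by apply: eq_bigr => j _; rewrite addrC.
  rewrite bigA_distr/=; apply: eq_bigr => K _.
  rewrite -big_split/= [RHS]big_mkcond/=; apply: eq_bigr => j _.
  by rewrite mulN1r.
transitivity (\sum_(E in powerset V) \sum_(K : {set J})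
    bernoulli V a E * ((\prod_(j in K) -1) * \prod_(j in K) (B j \subset E)%:R)).
  by apply: eq_bigr => E _; rewrite -mulr_sumr; congr (_ * _); exact: expand.
rewrite exchange_big [RHS](expand (fun j => \prod_(p in B j) a p))/=.
apply: eq_bigr => K _.
have BKV : (\bigcup_(j in K) B j)%SET \subset V by apply/bigcupsP.
(* Disjointness merges the products into one over the union, to which [bernoulli_superset]
   applies. *)
have -> : \prod_(j in K) \prod_(p in B j) a p =
    \prod_(p in (\bigcup_(j in K) B j)%SET) a p.
  rewrite (big_mkcond (mem K) B)/= partition_disjoint_bigcup => [|i j ij].
    rewrite big_mkcond; apply: eq_bigr => j _.
    by case: ifP => // _; rewrite big_set0.
  by do 2?[case: ifP => _]; rewrite ?Bdisj// -setI_eq0 ?set0I ?setI0.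
rewrite -(bernoulli_superset a BKV) mulr_sumr [RHS]big_mkcondr/=.
apply: eq_bigr => E _; rewrite mulrCA.
case: ifPn => [/bigcupsP h|/bigcupsP h].
  by congr (_ * _); rewrite big1 ?mulr1// => j jK; rewrite h.
have [j /andP[jK jE]] : exists j, (j \in K) && ~~ (B j \subset E).
  apply/existsP; apply: contra_notT h => /existsPn h j jK.
  by have := h j; rewrite jK negbK.
by rewrite [X in _ * (_ * X)](bigD1 j)//= (negPf jE) mul0r !mulr0.
Qed.

End bernoulli_product.

(** * Clique number of a random graph at fixed sample points *)

Lemma leq_clique_number n (E : {set 'I_n * 'I_n}) (K : {set 'I_n}) :
  is_clique E K -> (#|K| <= clique_number E)%N.
Proof. by move=> cK; exact: (leq_bigmax_cond (F := fun K : {set 'I_n} => #|K|)). Qed.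

(** The maps [h j] place disjoint blocks of [k] vertices, increasingly so that [vpairs k] lands in
    [vpairs n]. For each [E], either some block is complete and the clique number is at least [k],
    or the indicator of avoiding all blocks is 1; average over [E]. *)
Lemma bernoulli_clique_number_ge (R : realDomainType) (n k : nat) (J : finType)
    (h : J -> 'I_k -> 'I_n) (a : 'I_n * 'I_n -> R) :
    (forall p, 0 <= a p <= 1) ->
    (forall j, {mono h j : i1 i2 / (i1 < i2)%N}) ->
    (forall j1 j2 i1 i2, h j1 i1 = h j2 i2 -> j1 = j2) ->
  k%:R <= \sum_(E in powerset (vpairs n))
            (clique_number E)%:R * bernoulli (vpairs n) a E +
          k%:R * \prod_j (1 - \prod_(p in vpairs k) a (h j p.1, h j p.2)).
Proof.
move=> a01 hmono hdisj.
have hinj j : injective (h j).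
  move=> i1 i2 e; apply: val_inj.
  have := hmono j i1 i2; have := hmono j i2 i1; rewrite e ltnn.
  by case: ltngtP.
pose B j := [set (h j p.1, h j p.2) | p in vpairs k]%SET.
have BV j : B j \subset vpairs n.
  by apply/subsetP => _ /imsetP[p pk ->]; rewrite inE/= hmono; rewrite inE in pk.
have Bdisj i j : i != j -> [disjoint B i & B j].
  move=> ij; rewrite -setI_eq0; apply: contra_neqT ij => /set0Pn[q].
  by rewrite inE => /andP[/imsetP[p _ ->] /imsetP[p' _ [+ _]]]; exact: hdisj.
have prodB j : \prod_(p in B j) a p =
    \prod_(p in vpairs k) a (h j p.1, h j p.2).
  by rewrite big_imset//= => -[p1 p2] [q1 q2] _ _ /= [/hinj -> /hinj ->].
under [in X in _ + X]eq_bigr do rewrite -prodB.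
rewrite -(bernoulli_avoid a BV Bdisj) mulr_sumr -big_split/=.
(* Total mass 1, the case of the empty set in [bernoulli_superset], spreads the constant [k] over
   [E] for a termwise comparison. *)
have sum1 : \sum_(E in powerset (vpairs n)) bernoulli (vpairs n) a E = 1.
  rewrite -[RHS](big_set0 _ *%R a) -(bernoulli_superset a (sub0set (vpairs n))).
  by apply: eq_bigl => E; rewrite sub0set andbT.
rewrite -[leLHS]mulr1 -[X in _ * X <= _]sum1.
rewrite mulr_sumr; apply: ler_sum => E _.
have b0 : 0 <= bernoulli (vpairs n) a E.
  apply: prodr_ge0 => p _; case: ifP => _; have /andP[] := a01 p => //.
  by rewrite subr_ge0.
rewrite mulrCA [in leRHS]mulrC -mulrDr [leLHS]mulrC ler_wpM2l//.
have [/existsP[j jE]|/existsPn noB] := boolP [exists j, B j \subset E].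
  rewrite (bigD1 j)//= jE subrr mul0r mulr0 addr0 ler_nat.
  rewrite -{1}(card_ord k) -cardsT -(card_imset _ (hinj j)).
  apply: leq_clique_number; apply/forall_inP => _ /imsetP[x _ ->].
  apply/forall_inP => _ /imsetP[y _ ->]; apply/implyP => /eqP xy.
  have Bp (i1 i2 : 'I_k) : (i1 < i2)%N -> (h j i1, h j i2) \in E.
    move=> lt12; apply: (subsetP jE); apply/imsetP.
    by exists (i1, i2); rewrite ?inE.
  rewrite /adj; have [xy'|xy'|/val_inj e] := ltngtP x y.
  - by rewrite Bp.
  - by rewrite [X in _ || X]Bp// orbT.
  - by rewrite e in xy.
rewrite big1 ?mulr1 ?lerDr ?ler0n// => j _.
by rewrite (negPf (noB j)) subr0.
Qed.

Lemma prod_vpairs (R : comNzRingType) k (f : 'I_k -> 'I_k -> R) :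
  \prod_(p in vpairs k) f p.1 p.2 = \prod_(i < k) \prod_(j < k | (i < j)%N) f i j.
Proof. by rewrite pair_big_dep/=; apply: eq_bigl => p; rewrite inE. Qed.

From mathcomp Require Import all_classical all_reals all_analysis.
From mathcomp Require Import measurable_realfun lra zify.
Import numFieldNormedType.Exports.
Local Open Scope classical_set_scope.
Local Open Scope ring_scope.

(** * Integration over independent samples *)

Section tuple_power_integral.
Context (R : realType) d (T : measurableType d) (nu : probability T R).

Lemma integral_tuple_powerS n (f : n.+1.-tuple T -> \bar R) :
    measurable_fun [set: n.+1.-tuple T] f -> (forall x, 0 <= f x)%E ->
  (\int[tuple_power nu n.+1]_x f x =
   \int[nu]_x \int[tuple_power nu n]_y f (tcons (x, y)))%E.
Proof.
move=> mf f0; rewrite ge0_integral_distribution//.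
rewrite fubini_tonelli1//.
- by apply: measurableT_comp => //; exact: measurable_tcons.
- by move=> x; exact: f0.
Qed.

(* Integrands are functions on sequences, so that splitting a tuple with take and
   drop requires no cast between tuple types. *)
Definition seq_measurable (f : seq T -> \bar R) :=
  forall n, measurable_fun [set: n.-tuple T] (fun x : n.-tuple T => f x).

Lemma seq_measurable_cons f x :
  seq_measurable f -> seq_measurable (fun s => f (x :: s)).
Proof.
move=> mf n.
apply: (measurableT_comp (f := fun x : n.+1.-tuple T => f x)
  (g := fun y : n.-tuple T => tcons (x, y))); first exact: mf.
exact: (measurableT_comp (@measurable_tcons d T n) (pair1_measurable x)).
Qed.

Lemma measurable_nth x0 i n :
  measurable_fun [set: n.-tuple T] (fun x : n.-tuple T => nth x0 x i).
Proof.
have [ni|ni] := ltnP i n.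
  rewrite (_ : (fun _ => _) = (fun x : n.-tuple T => tnth x (Ordinal ni))).
    exact: measurable_tnth.
  by apply/funext => x; rewrite (tnth_nth x0).
rewrite (_ : (fun _ => _) = cst x0); first exact: measurable_cst.
by apply/funext => x; rewrite nth_default// size_tuple.
Qed.

Lemma seq_measurable_take (x0 : T) f k :
  seq_measurable f -> seq_measurable (fun s => f (take k s)).
Proof.
move=> mf n.
apply: (measurableT_comp (f := fun x : (minn k n).-tuple T => f x)
  (g := fun x : n.-tuple T => [tuple of take k x])); first exact: mf.
apply/measurable_fun_tnthP => i /=.
rewrite (_ : _ \o _ = fun x : n.-tuple T => nth x0 x i); first exact: measurable_nth.
apply/funext => x; rewrite /= (tnth_nth x0)/= nth_take//.
by rewrite (leq_trans (ltn_ord i)) ?geq_minl.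
Qed.

Lemma seq_measurable_drop (x0 : T) f k :
  seq_measurable f -> seq_measurable (fun s => f (drop k s)).
Proof.
move=> mf n.
apply: (measurableT_comp (f := fun x : (n - k).-tuple T => f x)
  (g := fun x : n.-tuple T => [tuple of drop k x])); first exact: mf.
apply/measurable_fun_tnthP => i /=.
rewrite (_ : _ \o _ = fun x : n.-tuple T => nth x0 x (k + i)).
  exact: measurable_nth.
by apply/funext => x; rewrite /= (tnth_nth x0)/= nth_drop.
Qed.

(** Independence of the first [k] samples from the other [n]. Induction on [k] peels off the first
    sample [x] by Tonelli and replaces [f] by [fun s => f (x :: s)]. *)
Lemma integral_take_drop (x0 : T) k n f g :
    seq_measurable f -> (forall s, 0 <= f s)%E ->
    seq_measurable g -> (forall s, 0 <= g s)%E ->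
  (\int[tuple_power nu (k + n)]_x (f (take k x) * g (drop k x)) =
   (\int[tuple_power nu k]_x f x) * \int[tuple_power nu n]_x g x)%E.
Proof.
move=> + + mg g0; elim: k f => [|k IH] f mf f0.
  rewrite [X in (X * _)%E]integral_dirac//; last exact: mf.
  rewrite diracE in_setT mul1e -ge0_integralZl//; last exact: mg.
  by apply: eq_integral => x _; rewrite take0 drop0.
rewrite [LHS](integral_tuple_powerS (n := k + n)
  (f := fun x => f (take k.+1 x) * g (drop k.+1 x)))%E; last 2 first.
  - apply: emeasurable_funM; first exact: (seq_measurable_take x0 k.+1 mf).
    exact: (seq_measurable_drop x0 k.+1 mg).
  - by move=> x; rewrite mule_ge0.
rewrite (integral_tuple_powerS (mf k.+1))//.
under eq_integral => x _.
  rewrite /=.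
  have -> : (\int[tuple_power nu (k + n)]_y (f (x :: take k y) * g (drop k y)) =
    (\int[tuple_power nu k]_y f (x :: y)) * \int[tuple_power nu n]_x g x)%E.
    by apply: (IH (fun s => f (x :: s))) => //; exact: seq_measurable_cons.
  over.
rewrite ge0_integralZr//.
- apply: (measurable_fun_fubini_tonelli_F (m2 := tuple_power nu k)
    (fun p : T * k.-tuple T => f (tcons p))) => //.
  exact: (measurableT_comp (mf k.+1) (@measurable_tcons d T k)).
- by move=> x _; exact: integral_ge0.
- exact: integral_ge0.
Qed.

End tuple_power_integral.

(** * Countably-partite sets and exhaustion by measure *)

Section countably_partite.
Context (R : realType) d (T : measurableType d) (nu : probability T R).
Variable W : T * T -> R.

Definition independent_set (A : set T) :=
  measurable A /\ (nu \x nu)%E ((A `*` A) `&` [set p | W p != 0]) = 0%E.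

(** Covers, rather than partitions, pass directly to subsets and countable unions; [seqDU] makes the
    final cover disjoint. *)
Definition countably_partite (A : set T) :=
  exists2 F : (set T)^nat, forall i, independent_set (F i) &
    A `<=` \bigcup_i F i.

Lemma independent_set0 : independent_set set0.
Proof. by split=> //; rewrite set0X set0I measure0. Qed.

Lemma countably_partite0 : countably_partite set0.
Proof. by exists (fun=> set0) => // _; exact: independent_set0. Qed.

Lemma countably_partite_bigcup (A : (set T)^nat) :
  (forall n, countably_partite (A n)) -> countably_partite (\bigcup_n A n).
Proof.
move=> /(_ _)/cid2 cpA; pose F n := sval (cpA n).
have indF n i : independent_set (F n i) by rewrite /F; case: (cpA n).
have AF n : A n `<=` \bigcup_i F n i by rewrite /F; case: (cpA n).
(* All the covers are listed together through codes of pairs; other codes give the empty set. *)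
exists (fun m => if unpickle m is Some (n, i) then F n i else set0).
  by move=> m; case: unpickle => [[n i]|]; [exact: indF|exact: independent_set0].
move=> x [n _ /AF[i _ Fx]]; exists (pickle (n, i)) => //.
by rewrite pickleK.
Qed.

Lemma countably_partiteU A B : countably_partite A -> countably_partite B ->
  countably_partite (A `|` B).
Proof.
move=> cA cB; rewrite -bigcup2E.
by apply: countably_partite_bigcup => -[|[|n]]//=; exact: countably_partite0.
Qed.

(* Exhaustion: B has the largest measure among the countably-partite sets. *)
Lemma maximal_countably_partite : exists B, [/\ measurable B,
  countably_partite B & forall C, measurable C -> countably_partite C ->
    nu (C `\` B) = 0%E].
Proof.
pose S := [set x | exists C, [/\ measurable C, countably_partite C & x = nu C]].
have S0 : S 0%E.
  by exists set0; split; rewrite ?measure0//; exact: countably_partite0.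
have Sle C : measurable C -> countably_partite C -> (nu C <= ereal_sup S)%E.
  by move=> mC cC; apply: ereal_sup_ubound; exists C.
have Sfin : ereal_sup S \is a fin_num.
  rewrite ge0_fin_numE; last exact: ereal_sup_ubound.
  rewrite (@le_lt_trans _ _ 1%E) ?ltry//.
  by apply: ge_ereal_sup => _ [C [mC _ ->]]; exact: probability_le1.
have /(_ _)/cid approx n : exists C, [/\ measurable C, countably_partite C &
    (ereal_sup S - n.+1%:R^-1%:E < nu C)%E].
  have [|_ [C [mC cC ->]] ltC] := @ub_ereal_sup_adherent _ S n.+1%:R^-1 _ Sfin.
    by rewrite invr_gt0.
  by exists C.
pose C n := sval (approx n).
have mC n : measurable (C n) by rewrite /C; case: (approx n) => ? [].
have cC n : countably_partite (C n) by rewrite /C; case: (approx n) => ? [].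
have ltC n : (ereal_sup S - n.+1%:R^-1%:E < nu (C n))%E.
  by rewrite /C; case: (approx n) => ? [].
pose B := \bigcup_n C n.
have mB : measurable B by exact: bigcupT_measurable.
have cB : countably_partite B by exact: countably_partite_bigcup.
have leB : (ereal_sup S <= nu B)%E.
  apply/lee_addgt0Pr => e e0.
  have [n ne] : exists n, n.+1%:R^-1 <= e.
    exists (Num.truncn e^-1); rewrite -[leRHS]invrK lef_pV2 ?posrE ?invr_gt0//.
    by apply/ltW; rewrite truncnS_gt.
  have := ltC n; rewrite lteBlDr// => /ltW/le_trans; apply.
  apply: leeD; last by rewrite lee_fin.
  by apply: le_measure; rewrite ?inE//; exact: bigcup_sup.
exists B; split => // D mD cD.
(* The union of [B] and [D] has measure [nu B + nu (D \ B)], at most the supremum and so at most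
   [nu B], which is finite. *)
have := Sle _ (measurableU _ _ mB mD) (countably_partiteU cB cD).
rewrite -(setDUK (@subsetUl _ B D)) setDUl setDv set0U measureU//; last 2 first.
  exact: measurableD.
  by rewrite setDE setICA setICr setI0.
move=> /le_trans/(_ leB).
have Bfin : nu B \is a fin_num by exact: fin_num_measure.
rewrite addeC -leeBrDr// subee// => le0.
by apply/eqP; rewrite eq_le le0/=.
Qed.

Lemma ae_eq0_integral (f : T -> \bar R) : measurable_fun setT f ->
    (forall x, 0 <= f x)%E ->
  (\int[nu]_x f x = 0)%E <-> {ae nu, forall x, f x = 0%E}.
Proof.
move=> mf f0; have := ae_eq_integral_abs nu measurableT mf.
rewrite (_ : (\int[nu]_x `|f x|)%E = (\int[nu]_x f x)%E); last first.
  by apply: eq_integral => x _; rewrite gee0_abs.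
move=> ->; split => h; near=> x.
  exact: (near h x).
by move=> _; exact: (near h x).
Unshelve. all: by end_near. Qed.

End countably_partite.

(** * Clique weights and induction on the clique size *)

Lemma measurable_neq0 (R : realType) d (T : measurableType d) (f : T -> R) :
  measurable_fun setT f -> measurable [set x | f x != 0].
Proof.
move=> mf; rewrite (_ : mkset _ = setT `&` f @^-1` (~` [set 0])).
  by apply: mf => //; exact: measurableC.
by rewrite setTI; apply/seteqP; split => x /= /eqP.
Qed.

Section clique_weight.
Context (R : realType) d (T : measurableType d) (nu : probability T R).
Variables (W : T * T -> R) (x0 : T).
Hypotheses (mW : measurable_fun [set: T * T] W) (W0 : forall p, 0 <= W p).

(** The vertex weight [u] lets induction on [k] close: fixing a vertex [x] replaces [u] by
    [fun y => u y * W (x, y)], which is supported on the neighbourhood of [x] in the support of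
    [u]. *)
Definition clique_weight (u : T -> R) k (s : seq T) : R :=
  (\prod_(i < k) u (nth x0 s i)) *
  \prod_(p in vpairs k) W (nth x0 s p.1, nth x0 s p.2).

(** The pairs containing vertex 0 supply the factors [W (x, y)] absorbed by the new vertex weight;
    the other pairs shift by one. *)
Lemma clique_weightS u k x s : clique_weight u k.+1 (x :: s) =
  u x * clique_weight (fun y => u y * W (x, y)) k s.
Proof.
rewrite /clique_weight !(prod_vpairs (fun i j => W (nth x0 _ i, nth x0 _ j))).
rewrite [X in _ * X = _]big_ord_recl [X in X * _ = _]big_ord_recl/= big_split/=.
rewrite -!mulrA; congr (_ * (_ * (_ * _))).
  by rewrite big_mkcond big_ord_recl/= mul1r.
by apply: eq_bigr => i _; rewrite big_mkcond big_ord_recl/= mul1r -big_mkcond.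
Qed.

Lemma clique_weight_ge0 u k s : (forall x, 0 <= u x) -> 0 <= clique_weight u k s.
Proof. by move=> u0; apply: mulr_ge0; apply: prodr_ge0. Qed.

Lemma seq_measurable_clique_weight u k : measurable_fun [set: T] u ->
  seq_measurable (fun s => (clique_weight u k s)%:E).
Proof.
move=> mu n; apply/measurable_EFinP; apply: measurable_funM.
  apply: measurable_prod => i _.
  exact: (measurableT_comp mu (@measurable_nth d T x0 i n)).
rewrite (_ : (fun _ => _) = fun x : n.-tuple T => \prod_(p <- enum (vpairs k))
  W (nth x0 x p.1, nth x0 x p.2)); last first.
  by apply/funext => x; rewrite big_enum.
apply: measurable_prod => p _; apply: (measurableT_comp mW).
exact: (measurable_fun_pair (@measurable_nth d T x0 p.1 n)
  (@measurable_nth d T x0 p.2 n)).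
Qed.

Lemma countably_partite_clique_free k (u : T -> R) :
    measurable_fun [set: T] u -> (forall x, 0 <= u x) ->
    (\int[tuple_power nu k]_x (clique_weight u k x)%:E = 0)%E ->
  countably_partite nu W [set x | u x != 0].
Proof.
elim: k u => [|k IH] u mu u0.
  (* For [k = 0] the weight is an empty product, so its integral is 1 and the hypothesis is
     contradictory. *)
  rewrite [X in X = _]integral_dirac//; last exact: (seq_measurable_clique_weight 0 mu).
  rewrite diracE in_setT mul1e /clique_weight big_ord0.
  rewrite big1 ?mulr1 => [[] /eqP|[[]]//].
  by rewrite oner_eq0.
have mcw x : measurable_fun setT (fun y => u y * W (x, y)).
  by apply: measurable_funM => //; exact: measurable_fun_pair2.
have cw0 x y : 0 <= u y * W (x, y) by rewrite mulr_ge0.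
rewrite (integral_tuple_powerS nu (seq_measurable_clique_weight k.+1 mu
  (n := k.+1))); last first.
  by move=> x; rewrite lee_fin clique_weight_ge0.
rewrite ae_eq0_integral; last 2 first.
- apply: (measurable_fun_fubini_tonelli_F (m2 := tuple_power nu k)
    (fun p : T * k.-tuple T => (clique_weight u k.+1 (tcons p))%:E)) => /=.
    exact: (measurableT_comp (seq_measurable_clique_weight k.+1 mu (n := k.+1))
      (@measurable_tcons d T k)).
  by move=> p; rewrite lee_fin clique_weight_ge0.
- by move=> x; apply: integral_ge0 => y _; rewrite lee_fin clique_weight_ge0.
move=> h.
have [B [mB cB maxB]] := maximal_countably_partite nu W.
(* Once [I] is shown independent, adding it to the cover of [B] covers the support of [u]. *)
pose I := [set x | u x != 0] `\` B.
have mI : measurable I by apply: measurableD => //; exact: measurable_neq0.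
pose N := (I `*` I) `&` [set p | W p != 0].
have mN : measurable N.
  by apply: measurableI; [exact: measurableX|exact: measurable_neq0].
have indI : independent_set nu W I.
  (* The product measure of [N] integrates the measures of its sections, so almost every section has
     to be null. *)
  split => //; rewrite [LHS](_ : _ = \int[nu]_x nu (xsection N x))%E//.
  apply/ae_eq0_integral => //; first exact: (measurable_fun_xsection nu mN).
  near=> x.
  have hx : (\int[tuple_power nu k]_y (clique_weight u k.+1 (x :: y))%:E = 0)%E.
    exact: (near h x).
  have [Ix|nIx] := pselect (I x); last first.
    rewrite (_ : xsection N x = set0) ?measure0//.
    by apply/seteqP; split => y //; rewrite /xsection/= inE => -[[]].
  have ux : 0 < u x by rewrite lt_neqAle eq_sym u0 andbT; case: Ix.
  (* The factor [u x] is positive and can be cancelled from [hx], leaving the induction hypothesis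
     for the neighbourhood of [x]. *)
  have cx : countably_partite nu W [set y | u y * W (x, y) != 0].
    apply: IH => //.
    have : ((u x)%:E * \int[tuple_power nu k]_y
        (clique_weight (fun y => u y * W (x, y)) k y)%:E = 0)%E.
      rewrite -ge0_integralZl//; last 3 first.
      - exact: (seq_measurable_clique_weight k (mcw x)).
      - by move=> y _; rewrite lee_fin clique_weight_ge0.
      - by rewrite lee_fin.
      by rewrite -{}hx; apply: eq_integral => y _; rewrite clique_weightS.
    by move=> /eqP; rewrite mule_eq0 eqe gt_eqF//= => /eqP.
  (* The section lies in this neighbourhood and outside [B], hence is null by maximality of [B]. *)
  apply/eqP; rewrite eq_le measure_ge0 andbT.
  rewrite -(maxB _ _ cx)//; last exact: measurable_neq0.
  apply: le_measure; rewrite ?inE//.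
  - exact: measurable_xsection.
  - by apply: measurableD => //; exact: measurable_neq0.
  move=> y; rewrite /xsection/= inE => -[[_ [/= uy nBy]] Wxy].
  by split => //=; rewrite mulf_neq0.
have cI : countably_partite nu W I by exists (fun=> I) => // x Ix; exists 0%N.
have [F indF BIF] := countably_partiteU cB cI.
exists F => //; apply: subset_trans BIF => x ux.
by have [Bx|nBx] := pselect (B x); [left|right].
Unshelve. all: by end_near. Qed.

End clique_weight.

(** * Growth of the expected clique number from independent blocks *)

Section block_cliques.
Context (R : realType) d (T : measurableType d) (nu : probability T R).
Variables (W : T * T -> R) (x0 : T).
Hypotheses (mW : measurable_fun [set: T * T] W) (W01 : forall p, 0 <= W p <= 1).

Let W0 p : 0 <= W p. Proof. by case/andP: (W01 p). Qed.

Definition clique_prob k (s : seq T) : R := clique_weight W x0 (cst 1) k s.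

Lemma clique_probE k s : clique_prob k s =
  \prod_(p in vpairs k) W (nth x0 s p.1, nth x0 s p.2).
Proof. by rewrite /clique_prob /clique_weight big1 ?mul1r. Qed.

Lemma clique_prob_take k s : clique_prob k (take k s) = clique_prob k s.
Proof. by rewrite !clique_probE; apply: eq_bigr => p _; rewrite !nth_take. Qed.

Lemma clique_prob_ge0 k s : 0 <= clique_prob k s.
Proof. by rewrite clique_probE prodr_ge0. Qed.

Lemma clique_prob_le1 k s : clique_prob k s <= 1.
Proof. by rewrite clique_probE prodr_ile1. Qed.

(** Given the sample [s], the probability that none of its first [m] consecutive blocks of length
    [k] spans a clique. *)
Definition avoid_prob k m (s : seq T) : R :=
  \prod_(j < m) (1 - clique_prob k (drop (j * k) s)).

Lemma avoid_probS k m s :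
  avoid_prob k m.+1 s = (1 - clique_prob k s) * avoid_prob k m (drop k s).
Proof.
rewrite /avoid_prob big_ord_recl mul0n drop0; congr (_ * _).
by apply: eq_bigr => j _; rewrite drop_drop -mulSnr.
Qed.

Lemma avoid_prob_ge0 k m s : 0 <= avoid_prob k m s.
Proof. by apply: prodr_ge0 => j _; rewrite subr_ge0 clique_prob_le1. Qed.

Lemma seq_measurable_clique_prob k : seq_measurable (fun s => (clique_prob k s)%:E).
Proof. exact: seq_measurable_clique_weight. Qed.

Lemma seq_measurable_noclique k : seq_measurable (fun s => (1 - clique_prob k s)%:E).
Proof.
move=> n; apply/measurable_EFinP; apply: measurable_funB => //.
by apply/measurable_EFinP; exact: seq_measurable_clique_prob.
Qed.

Lemma seq_measurable_avoid_prob k m :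
  seq_measurable (fun s => (avoid_prob k m s)%:E).
Proof.
move=> n; apply/measurable_EFinP; apply: measurable_prod => j _.
apply/measurable_EFinP.
exact: (seq_measurable_drop x0 (j * k) (@seq_measurable_noclique k) (n := n)).
Qed.

(** The probabilities of no clique and of a clique are nonnegative and sum to 1, so both are finite
    and the first is below 1 once the second is nonzero. *)
Lemma integral_noclique k :
  exists q : R, [/\ (\int[tuple_power nu k]_x (1 - clique_prob k x)%:E = q%:E)%E,
    0 <= q & ((\int[tuple_power nu k]_x (clique_prob k x)%:E)%E != 0%E -> q < 1)].
Proof.
set q := (\int[tuple_power nu k]_x (1 - clique_prob k x)%:E)%E.
set p := (\int[tuple_power nu k]_x (clique_prob k x)%:E)%E.
have q0 : (0 <= q)%E.
  by apply: integral_ge0 => x _; rewrite lee_fin subr_ge0 clique_prob_le1.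
have p0 : (0 <= p)%E.
  by apply: integral_ge0 => x _; rewrite lee_fin clique_prob_ge0.
have pq : (q + p = 1)%E.
  rewrite -ge0_integralD//; last 4 first.
  - by move=> x _; rewrite lee_fin subr_ge0 clique_prob_le1.
  - exact: seq_measurable_noclique.
  - by move=> x _; rewrite lee_fin clique_prob_ge0.
  - exact: seq_measurable_clique_prob.
  under eq_integral do rewrite -EFinD subrK.
  by rewrite integral_cst// mul1e; exact: probability_setT.
clearbody p q; move: p q p0 q0 pq => [p| |] [q| |]//= p0 q0 [pq].
exists q; split => //; rewrite eqe => pneq0.
by rewrite -pq ltrDl lt_neqAle eq_sym pneq0.
Qed.

(** Blocks use disjoint, hence independent, samples: [integral_take_drop] splits off one factor [q]
    per block, and the last [r] samples integrate to 1. *)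
Lemma integral_avoid_prob k m r q :
    (\int[tuple_power nu k]_x (1 - clique_prob k x)%:E = q%:E)%E ->
  (\int[tuple_power nu (m * k + r)]_x (avoid_prob k m x)%:E = (q ^+ m)%:E)%E.
Proof.
move=> hq; elim: m => [|m IH].
  under eq_integral do rewrite /avoid_prob big_ord0.
  by rewrite integral_cst// mul1e; exact: probability_setT.
rewrite mulSn -addnA exprS EFinM -IH -hq -(@integral_take_drop R d T nu x0 k (m * k + r)
  (fun s => (1 - clique_prob k s)%:E) (fun s => (avoid_prob k m s)%:E)); last 4 first.
- exact: seq_measurable_noclique.
- by move=> s; rewrite lee_fin subr_ge0 clique_prob_le1.
- exact: seq_measurable_avoid_prob.
- by move=> s; rewrite lee_fin avoid_prob_ge0.
by apply: eq_integral => x _; rewrite avoid_probS clique_prob_take EFinM.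
Qed.

Lemma graph_weight_ge0 n (x : n.-tuple T) E : 0 <= graph_weight W x E.
Proof.
apply: prodr_ge0 => p _; case: ifP => _ //; rewrite subr_ge0.
by case/andP: (W01 (tnth x p.1, tnth x p.2)).
Qed.

Lemma measurable_graph_weight n E :
  measurable_fun [set: n.-tuple T] (fun x => graph_weight W x E).
Proof.
rewrite (_ : (fun _ => _) = fun x : n.-tuple T => \prod_(p <- enum (vpairs n))
    (if p \in E then W (tnth x p.1, tnth x p.2)
     else 1 - W (tnth x p.1, tnth x p.2))); last first.
  by apply/funext => x; rewrite big_enum.
have mWp (p : 'I_n * 'I_n) : measurable_fun [set: n.-tuple T]
    (fun x => W (tnth x p.1, tnth x p.2)).
  apply: (measurableT_comp mW).
  exact: (measurable_fun_pair (measurable_tnth p.1) (measurable_tnth p.2)).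
apply: measurable_prod => p _; case: (p \in E) => //.
exact: measurable_funB.
Qed.

(** Integrates [bernoulli_clique_number_ge] over the sample, with [j * k + i] as vertex [i] of block
    [j]. The [r] spare vertices allow every [n] from [m * k] on. *)
Lemma expected_clique_number_blocks k m r q :
    (\int[tuple_power nu k]_x (1 - clique_prob k x)%:E = q%:E)%E ->
  (k%:R%:E <= expected_clique_number nu W (m * k + r) + (k%:R * q ^+ m)%:E)%E.
Proof.
move=> hq; set n := (m * k + r)%N.
have hn (j : 'I_m) (i : 'I_k) : (j * k + i < n)%N.
  rewrite /n; have := ltn_ord i; have := ltn_ord j; nia.
pose h (j : 'I_m) (i : 'I_k) := Ordinal (hn j i).
have pointwise (x : n.-tuple T) :
    k%:R <= \sum_(E in powerset (vpairs n))
        (clique_number E)%:R * graph_weight W x E + k%:R * avoid_prob k m x.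
  have := @bernoulli_clique_number_ge R n k 'I_m h
    (fun p => W (tnth x p.1, tnth x p.2)) (fun p => W01 _).
  have -> : \prod_j (1 - \prod_(p in vpairs k)
      W (tnth x (h j p.1), tnth x (h j p.2))) = avoid_prob k m x.
    apply: eq_bigr => j _; rewrite clique_probE; congr (1 - _).
    by apply: eq_bigr => p _; rewrite !nth_drop !(tnth_nth x0).
  apply.
  - by move=> j i1 i2; rewrite /= ltn_add2l.
  (* The block index is recovered as the quotient of the vertex by [k]. *)
  - move=> j1 j2 i1 i2 [e]; apply: val_inj => /=.
    have k0 : (0 < k)%N by exact: leq_ltn_trans (ltn_ord i1).
    have := congr1 (fun a => a %/ k)%N e.
    by rewrite !divnMDl// !divn_small// !addn0.
have -> : k%:R%:E = (\int[tuple_power nu n]_x k%:R%:E)%E.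
  by rewrite integral_cst// [X in (_ * X)%E]probability_setT mule1.
have -> : expected_clique_number nu W n = (\int[tuple_power nu n]_x
    (\sum_(E <- enum (powerset (vpairs n)))
        ((clique_number E)%:R * graph_weight W x E)%:E))%E.
  rewrite ge0_integral_sum//; last 2 first.
  - move=> E; apply/measurable_EFinP; apply: measurable_funM => //.
    exact: measurable_graph_weight.
  - by move=> E x _; rewrite lee_fin mulr_ge0 ?graph_weight_ge0.
  rewrite big_enum/=; apply: eq_bigr => E _.
  under [RHS]eq_integral do rewrite EFinM.
  rewrite ge0_integralZl_EFin//.
  - by move=> x _; rewrite lee_fin graph_weight_ge0.
  - by apply/measurable_EFinP; exact: measurable_graph_weight.
rewrite EFinM -(integral_avoid_prob m r hq) -ge0_integralZl_EFin//; last 2 first.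
- by move=> x _; rewrite lee_fin avoid_prob_ge0.
- exact: seq_measurable_avoid_prob.
rewrite -ge0_integralD//; last 4 first.
- by move=> x _; apply: sume_ge0 => E _; rewrite lee_fin mulr_ge0 ?graph_weight_ge0.
- apply: emeasurable_sum => E; apply/measurable_EFinP; apply: measurable_funM => //.
  exact: measurable_graph_weight.
- by move=> x _; rewrite -EFinM lee_fin mulr_ge0// avoid_prob_ge0.
- apply: emeasurable_funM => //; exact: seq_measurable_avoid_prob.
apply: ge0_le_integral => //.
- apply: emeasurable_funD.
    apply: emeasurable_sum => E; apply/measurable_EFinP; apply: measurable_funM => //.
    exact: measurable_graph_weight.
  apply: emeasurable_funM => //; exact: seq_measurable_avoid_prob.
- by move=> x _; rewrite sumEFin big_enum -EFinM -EFinD lee_fin pointwise.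
Qed.

Lemma expected_clique_number_cvgy :
    (forall k, (\int[tuple_power nu k]_x (clique_prob k x)%:E)%E != 0%E) ->
  expected_clique_number nu W n @[n --> \oo] --> +oo%E.
Proof.
move=> pn0; apply/cvgeyPge => A.
(* This [k] is at least [A + 1]; the spare 1 absorbs the error [k * q ^+ m], made at most 1 by the
   choice of [m]. *)
pose k := (Num.truncn `|A|).+2.
have Ak : A + 1 <= k%:R.
  rewrite /k -natr1 lerD2r (le_trans (ler_norm A))//.
  by apply/ltW; rewrite truncnS_gt.
have [q [hq q0 /(_ (pn0 k)) q1]] := integral_noclique k.
have [m hm] : exists m, k%:R * q ^+ m <= 1.
  have : (fun m => k%:R * q ^+ m) @ \oo --> (k%:R * 0 : R).
    by apply: cvgMl_tmp; apply: cvg_expr; rewrite ger0_norm.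
  rewrite mulr0 => /cvgrPdist_le/(_ 1 ltr01)[m _ /(_ m (leqnn m))] /=.
  rewrite sub0r normrN => h; exists m.
  exact: le_trans (ler_norm _) h.
exists (m * k)%N => // n /= mn.
have := expected_clique_number_blocks m (n - m * k) hq.
rewrite subnKC//.
set e := expected_clique_number _ _ _; case: e => [e| |]//=; rewrite ?leey//.
by rewrite -EFinD !lee_fin; lra.
Qed.

End block_cliques.

Theorem theorem2p3 (R : realType) (d : measure_display) (T : measurableType d)
    (nu : probability T R) (W : T * T -> R)
    (hT : standard_borel R T) (hnu : atomless nu) (hW : is_graphon W)
    (hbounded : (limn (fun n => expected_clique_number nu W n) < +oo)%E) :
  exists F : (set T)^nat,
    [/\ forall i, measurable (F i),
        trivIset [set: nat] F,
        \bigcup_i F i = [set: T] &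
        forall i, {ae (nu \x nu)%E, forall p, (F i `*` F i) p -> W p = 0}].
Proof.
case: hW => mW _ W01'.
have W01 p : 0 <= W p <= 1 by case: p.
(* A space of measure 1 is nonempty, which yields the default point for [nth]. *)
have [x0 _] : [set: T] !=set0.
  apply/set0P/eqP => T0; have := probability_setT nu.
  by rewrite T0 measure0 => /eqP; rewrite eqe eq_sym oner_eq0.
have [k pk0] : exists k,
    (\int[tuple_power nu k]_x (clique_prob W x0 k x)%:E = 0)%E.
  apply: contrapT => /forallNP pn0.
  have /cvg_lim lim : expected_clique_number nu W n @[n --> \oo] --> +oo%E.
    by apply: expected_clique_number_cvgy => // k; apply/eqP; exact: pn0.
  by move: hbounded; rewrite lim// ltxx.
have W0 p : 0 <= W p by case/andP: (W01 p).
(* With constant weight 1 the support is the whole space. *)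
have [F indF FT] : countably_partite nu W [set x | (cst 1 x : R) != 0].
  by apply: (@countably_partite_clique_free R d T nu W x0 mW W0 k (cst 1)).
exists (seqDU F); split.
- by move=> i; apply: seqDU_measurable => j; case: (indF j).
- exact: trivIset_seqDU.
- rewrite -seqDU_bigcup_eq; apply/seteqP; split => // x _.
  by apply: FT => /=; rewrite oner_neq0.
move=> i; have [mF F0] := indF i.
(* The disjoint piece [seqDU F i] lies in [F i], so the null set of [F i] contains all
   exceptions. *)
exists ((F i `*` F i) `&` [set p | W p != 0]); split => //.
  by apply: measurableI; [exact: measurableX|exact: measurable_neq0].
move=> p /= /not_implyP[[Fp1 Fp2] /eqP Wp].
by split => //; split; apply: subset_seqDU; eassumption.
Qed.
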